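(* Let $L \geq 3$ be an odd integer and set $k = \frac{L-1}{2}$. Fix a discrete memoryless channel $P_{Y|X}\colon \mathcal{X}\to\mathcal{Y}$, a distribution $P_X$ on $\mathcal{X}$, control symbols $x_{\mathsf{A}}, x_{\mathsf{R}} \in \mathcal{X}$, positive integers $M$ and $n_1 < n_2 < \dots < n_L$, and type-I error probabilities $\epsilon^{(i)} \in (0,1)$ for $i \in [k]$. Set $n_0 = 0$ and $n_{L+1} = n_L$, and define $$\beta^{(i)} \triangleq \beta_{\epsilon^{(i)}}\left(P_{Y|X=x_{\mathsf{A}}}^{\,n_{2i}-n_{2i-1}} \,\middle\|\, P_{Y|X=x_{\mathsf{R}}}^{\,n_{2i}-n_{2i-1}}\right), \quad i \in [k],$$ $$p^{(0)} \triangleq 1, \qquad p^{(i)} \triangleq \max\{\epsilon^{(i)}, 1-\beta^{(i)}\}, \quad i \in [k].$$ Then there exists an $(N, L, M, \epsilon)$-VLBF code with feedback times $n_1,\dots,n_L$ satisfying $$N \leq n_2 + \sum_{j=1}^{k} (n_{2j+2}-n_{2j})\left(\mathrm{rcu}\Big(\sum_{i=1}^{j} (n_{2i-1}-n_{2i-2}), M\Big)\big(1-\beta^{(j)}\big) + \epsilon^{(j)}\right)\prod_{i=0}^{j-1} p^{(i)},$$ $$\epsilon \leq \sum_{j=1}^{k} \mathrm{rcu}\Big(\sum_{i=1}^{j} (n_{2i-1}-n_{2i-2}), M\Big)\,\beta^{(j)} \prod_{i=0}^{j-1} p^{(i)} + \mathrm{rcu}\Big(\sum_{i=1}^{k+1}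 (n_{2i-1}-n_{2i-2}), M\Big)\prod_{i=0}^{k} p^{(i)}.$$ (That is, there is a VLBF code with $M$ messages and feedback times $n_1<\dots<n_L$ whose expected decoding time is at most the first right-hand side and whose average error probability is at most the second right-hand side.)
   Context: Notation: $[n]=\{1,\dots,n\}$; $x^n=(x_1,\dots,x_n)$. A discrete memoryless channel (DMC) with finite input alphabet $\mathcal{X}$ and output alphabet $\mathcal{Y}$ is given by a transition kernel $P_{Y|X}$ and acts as $P_{Y^n|X^n}(y^n|x^n)=\prod_{i=1}^n P_{Y|X}(y_i|x_i)$. For $x\in\mathcal{X}$ and an integer $m\ge 1$, $P^{m}_{Y|X=x}$ denotes the product distribution on $\mathcal{Y}^m$ of $m$ i.i.d. outputs with input $x$. VLBF code: Given $\epsilon\in(0,1)$, $N>0$, and positive integers $M$ and $n_1<\dots<n_L$, an $(N,L,M,\epsilon)$ variable-length bursty-feedback (VLBF) code consists of: (1) a common randomness random variable $U$ with finite alphabet $\mathcal{U}$ and distribution $P_U$, known to transmitter and receiver before transmission; (2) encoding functions $\mathsf{f}_n\colon \mathcal{U}\times[M]\times\mathcal{Y}^{h(n-1)}\to\mathcal{X}$, $n=1,\dots,n_L$, where $h(n)\triangleq\max\{t\in\{0,n_1,\dots,n_L\}\colon t\le n\}$, producing channel inputs $X_n=\mathsf{f}_n(U,W,Y^{h(n-1)})$ (so the transmitter learns the past channel outputs only at the times $n_1,\dots,n_L$); (3) a stopping time $\tau\in\{n_1,\dots,n_L\}$ of the filtration generated by $\{U,Y^{n_i}\}_{i=1}^L$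 with $\mathbb{E}[\tau]\le N$; (4) decoding functions $\mathsf{g}_{n_i}\colon\mathcal{U}\times\mathcal{Y}^{n_i}\to[M]$, $i\in[L]$, with estimate $\hat W=\mathsf{g}_\tau(U,Y^\tau)$, such that when the message $W$ is uniform on $[M]$, $\mathbb{P}[\hat W\ne W]\le\epsilon$. RCU function: for integer $n\ge1$ and $M$, with $P_{X^n}=P_X^{n}$ (i.i.d. $P_X$), $$\mathrm{rcu}(n,M)\triangleq\mathbb{E}\left[\min\left\{1,(M-1)\,\mathbb{P}\left[\iota(\bar X^n;Y^n)\ge\iota(X^n;Y^n)\,\middle|\,X^n,Y^n\right]\right\}\right],$$ where $(X^n,\bar X^n,Y^n)$ has joint distribution $P_{X^n}(x^n)P_{X^n}(\bar x^n)P_{Y^n|X^n}(y^n|x^n)$, and $\iota(x^n;y^n)=\log\frac{P_{Y^n|X^n}(y^n|x^n)}{P_{Y^n}(y^n)}$ with $P_{Y^n}$ the output distribution induced by $P_{X^n}$. Binary hypothesis testing: for distributions $P_{\mathsf{A}},P_{\mathsf{R}}$ on a common finite alphabet, a randomized test is a kernel $P_{B|X}$ to $\{\mathsf{A},\mathsf{R}\}$, and $\beta_\epsilon(P_{\mathsf{A}}\|P_{\mathsf{R}})\triangleq\min\{\mathbb{P}[B=\mathsf{A}\mid X\sim P_{\mathsf{R}}]\colon \mathbb{P}[B=\mathsf{R}\mid X\sim P_{\mathsf{A}}]\le\epsilon\}$, the minimum type-II error probability subject to type-I error probability at most $\epsilon$. *)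

(* Defs.v *)
From HB Require Import structures.
From mathcomp Require Import all_boot all_order all_algebra.
From mathcomp Require Import boolp classical_sets reals constructive_ereal ereal exp.
Set Implicit Arguments. Unset Strict Implicit. Unset Printing Implicit Defensive.
Import Order.TTheory GRing.Theory Num.Theory.
Local Open Scope ring_scope.

Section VLBF.
Variables (R : realType) (X Y : finType).

Definition is_dist (T : finType) (p : T -> R) :=
  (forall t, 0 <= p t) /\ \sum_(t : T) p t = 1.

Definition is_channel (W : X -> Y -> R) := forall x, is_dist (W x).

Definition prod_dist (T : finType) (m : nat) (p : T -> R) (t : {ffun 'I_m -> T}) : R :=
  \prod_(i < m) p (t i).

Definition chan_n (W : X -> Y -> R) (m : nat)
  (x : {ffun 'I_m -> X}) (y : {ffun 'I_m -> Y}) : R :=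
  \prod_(i < m) W (x i) (y i).

Definition out_n (W : X -> Y -> R) (PX : X -> R) (m : nat) (y : {ffun 'I_m -> Y}) : R :=
  \sum_(x : {ffun 'I_m -> X}) @prod_dist _ m PX x * chan_n W x y.

Definition info_dens (W : X -> Y -> R) (PX : X -> R) (m : nat)
  (x : {ffun 'I_m -> X}) (y : {ffun 'I_m -> Y}) : \bar R :=
  let r := chan_n W x y / out_n W PX y in
  if 0 < r then (ln r)%:E else -oo%E.

Definition rcu (W : X -> Y -> R) (PX : X -> R) (m M : nat) : R :=
  \sum_(x : {ffun 'I_m -> X}) \sum_(y : {ffun 'I_m -> Y})
    @prod_dist _ m PX x * chan_n W x y *
    Num.min 1 ((M%:R - 1) *
      \sum_(xb : {ffun 'I_m -> X})
        @prod_dist _ m PX xb * ((info_dens W PX x y <= info_dens W PX xb y)%E)%:R).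

(* beta_eps(PA || PR): least type-II error of randomized tests with type-I
   error at most eps; T t = P[B = A | t].  (min = inf, attained.) *)
Definition beta_eps (T : finType) (eps : R) (PA PR : T -> R) : R :=
  inf [set b | exists tst : T -> R,
        (forall t, 0 <= tst t <= 1) /\
        \sum_(t : T) PA t * (1 - tst t) <= eps /\
        b = \sum_(t : T) PR t * tst t].

Definition hfb (L : nat) (n : nat -> nat) (m : nat) : nat :=
  \max_(i < L | (n i.+1 <= m)%N) n i.+1.

Definition prefix_eq (N m : nat) (y y' : {ffun 'I_N -> Y}) :=
  forall t : 'I_N, (t < m)%N -> y t = y' t.

(* A VLBF code with M messages and feedback times n 1 < ... < n L.
   Outputs y : Y^{n_L}, coordinate t being the output at time t+1.
   enc t u w y : channel input at time t+1 (must depend only on y^{h(t)}).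
   tau u y = i means the stopping time equals n_(i+1).
   dec i u y : decoder g_{n_(i+1)} (must depend only on y^{n_(i+1)}). *)
Record vlbf_code (L M : nat) (n : nat -> nat) := VLBF {
  cr : finType;
  PU : cr -> R;
  enc : nat -> cr -> 'I_M -> {ffun 'I_(n L) -> Y} -> X;
  tau : cr -> {ffun 'I_(n L) -> Y} -> 'I_L;
  dec : 'I_L -> cr -> {ffun 'I_(n L) -> Y} -> 'I_M }.

Definition vlbf_valid L M n (c : vlbf_code L M n) :=
  is_dist (@PU L M n c) /\
  (forall t u w y y', prefix_eq (hfb L n t) y y' ->
      @enc L M n c t u w y = @enc L M n c t u w y') /\
  (forall u y y' (i : 'I_L), prefix_eq (n i.+1) y y' ->
      (@tau L M n c u y == i) = (@tau L M n c u y' == i)) /\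
  (forall (i : 'I_L) u y y', prefix_eq (n i.+1) y y' ->
      @dec L M n c i u y = @dec L M n c i u y').

Definition vlbf_joint (W : X -> Y -> R) L M n (c : vlbf_code L M n)
  (u : @cr L M n c) (w : 'I_M) (y : {ffun 'I_(n L) -> Y}) : R :=
  PU u / M%:R * \prod_(t < n L) W (@enc L M n c t u w y) (y t).

Definition vlbf_Etau (W : X -> Y -> R) L M n (c : vlbf_code L M n) : R :=
  \sum_(u : @cr L M n c) \sum_(w : 'I_M) \sum_(y : {ffun 'I_(n L) -> Y})
    vlbf_joint W u w y * (n (@tau L M n c u y).+1)%:R.

Definition vlbf_Perr (W : X -> Y -> R) L M n (c : vlbf_code L M n) : R :=
  \sum_(u : @cr L M n c) \sum_(w : 'I_M) \sum_(y : {ffun 'I_(n L) -> Y})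
    vlbf_joint W u w y * (@dec L M n c (@tau L M n c u y) u y != w)%:R.

End VLBF.
Arguments prod_dist {R T} m p t.

(* Main.v *)
(* Time is cut into data blocks and control blocks by the feedback instants.
   The data blocks carry an i.i.d. random codeword regardless of what the
   receiver does; after the j-th data block the receiver, and by feedback also
   the transmitter, forms the estimate that maximises the information density
   of all data received so far.  During the j-th control block the transmitter
   repeats xA if that estimate is right and xR otherwise, and the receiver runs
   an optimal randomised test on the block, whose coins are common randomness.
   It stops at the first acceptance, or at the last instant.

   Since the estimates depend on the data outputs only, given these outputs
   the tests are independent, the i-th one rejecting with probability at most
   p(i) and accepting a wrong estimate with probability beta(i).  Integrating
   out the control blocks thus leaves the error probability of a non-adaptive
   random code, which the RCU bound controls. *)
Require Import Defs.
From HB Require Import structures.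
From mathcomp Require Import all_boot all_order all_algebra.
From mathcomp Require Import boolp classical_sets reals constructive_ereal ereal exp.
From mathcomp Require Import topology normedtype derive ring.
Import Order.TTheory GRing.Theory Num.Theory.
Import numFieldNormedType.Exports.
Local Open Scope ring_scope.
Set Implicit Arguments. Unset Strict Implicit. Unset Printing Implicit Defensive.

(** * Optimal randomised tests *)

(** Tests with type-I error at most [eps] form a nonempty compact set of vectors in the unit cube,
    and the type-II error is continuous there, so the infimum is a minimum. *)
Lemma beta_epsP (R : realType) (T : finType) (eps : R) (PA PR : T -> R) :
  0 <= eps -> is_dist PA -> is_dist PR ->
  exists tst : T -> R, (forall t, 0 <= tst t <= 1) /\
    \sum_t PA t * (1 - tst t) <= eps /\
    beta_eps eps PA PR = \sum_t PR t * tst t.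
Proof.
move=> eps_ge0 [PA_ge0 PA1] [PR_ge0 PR1].
pose cube := [set v : 'rV[R]_#|T| | forall i, (`[0, 1]%classic : set R) (v ord0 i)]%classic.
pose typ1 (v : 'rV[R]_#|T|) := \sum_t PA t * (1 - v ord0 (enum_rank t)).
pose typ2 (v : 'rV[R]_#|T|) := \sum_t PR t * v ord0 (enum_rank t).
have coordc t : continuous (fun v : 'rV[R]_#|T| => v ord0 (enum_rank t)).
  exact: coord_continuous.
have typ1c : continuous typ1.
  apply: (@continuous_big R^o _ _ _ _ (@add_continuous R^o)) => t _ v.
  apply: (@continuousM R _ _ _ v); first exact: cst_continuous.
  by apply: (@continuousB R R^o); [exact: cst_continuous | exact: coordc].
have typ2c : continuous typ2.
  apply: (@continuous_big R^o _ _ _ _ (@add_continuous R^o)) => t _ v.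
  by apply: (@continuousM R _ _ _ v); [exact: cst_continuous | exact: coordc].
have Ac : compact (cube `&` (typ1 @^-1` [set x | x <= eps]%classic))%classic.
  apply: compact_closedI.
    by apply: (@rV_compact R _ (fun=> `[0, 1]%classic)) => _; exact: segment_compact.
  by move/continuous_closedP: typ1c; apply; exact: closed_le.
have A0 : (cube `&` (typ1 @^-1` [set x | x <= eps]%classic) !=set0)%classic.
  (* The test that always accepts has type-I error 0. *)
  exists (\row_i 1); split => [i|] /=.
    by rewrite /= mxE in_itv /= ler01 lexx.
  by rewrite /typ1 big1 // => t _; rewrite mxE subrr mulr0.
have typ2w : {within cube `&` (typ1 @^-1` [set x | x <= eps]), continuous typ2}%classic.
  exact: continuous_subspaceT.
have [v] := EVT_min_rV A0 Ac typ2w; rewrite inE => -[vcube vtyp1] vmin.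
exists (fun t => v ord0 (enum_rank t)); split.
  by move=> t; have := vcube (enum_rank t); rewrite /= in_itv.
split => //; rewrite /beta_eps.
set E := (X in inf X); have lbE : lbound E (typ2 v).
  move=> b [tst [tst01 [tst1 ->]]].
  have -> : \sum_t PR t * tst t = typ2 (\row_i tst (enum_val i)).
    by apply: eq_bigr => t _; rewrite mxE enum_rankK.
  apply: vmin; rewrite inE; split => [i|] /=; first by rewrite mxE in_itv /=.
  rewrite /typ1 (le_trans _ tst1) // ler_sum // => t _.
  by rewrite mxE enum_rankK.
have Ev : E (typ2 v).
  exists (fun t => v ord0 (enum_rank t)); split => //.
  by move=> t; have := vcube (enum_rank t); rewrite /= in_itv.
apply/eqP; rewrite eq_le; apply/andP; split.
  by apply: ge_inf => //; exists (typ2 v).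
by apply: lb_le_inf => //; exists (typ2 v).
Qed.

(** * Summing out blocks of coordinates *)

Section Fubini.
Variables (R : realType) (A I T : finType) (e : I -> A).
Hypothesis e_inj : injective e.

Let J := {a : A | a \notin codom e}.
Let h (s : I + J) : A := match s with inl i => e i | inr j => val j end.

Let h_bij : bijective h.
Proof.
apply: inj_card_bij.
  move=> [i|[j jP]] [i'|[j' jP']] //= => [/e_inj ->//|ej|ej|ej].
  - by have := codom_f e i; rewrite ej (negPf jP').
  - by have := codom_f e i'; rewrite -ej (negPf jP).
  - by congr inr; apply: val_inj.
by rewrite card_sum card_sig -(card_codom e_inj) cardC.
Qed.

Lemma sum_ffun_split (F : {ffun A -> T} -> R) :
  exists glue : {ffun I -> T} -> {ffun J -> T} -> {ffun A -> T},
    (forall f g i, glue f g (e i) = f i) /\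
    (forall f g j, glue f g (val j) = g j) /\
    \sum_f F f = \sum_g \sum_f F (glue f g).
Proof.
have [h' hK h'K] := h_bij.
pose glue (f : {ffun I -> T}) (g : {ffun J -> T}) : {ffun A -> T} :=
  [ffun a => match h' a with inl i => f i | inr j => g j end].
have gluel f g i : glue f g (e i) = f i by rewrite ffunE -[e i]/(h (inl i)) hK.
have gluer f g (j : J) : glue f g (val j) = g j.
  by rewrite ffunE -[val j]/(h (inr j)) hK.
exists glue; split=> //; split=> //.
rewrite exchange_big pair_bigA /=.
rewrite (reindex (fun p : {ffun I -> T} * {ffun J -> T} => glue p.1 p.2)) //=.
exists (fun f => ([ffun i => f (e i)], [ffun j => f (val j)])) => [[f g] _|f _].
  by congr pair; apply/ffunP => x; rewrite ffunE /= ?gluel ?gluer.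
apply/ffunP => a; rewrite -[a]h'K /=.
by case: (h' a) => [i|j] /=; rewrite ?gluel ?gluer ffunE.
Qed.

Lemma prod_split (K : A -> R) : \prod_a K a = \prod_i K (e i) * \prod_(j : J) K (val j).
Proof. by rewrite (reindex h) ?big_sumType //; exact: onW_bij. Qed.

(* Conditioning on the coordinates outside the image of e: only there may the
   kernels K' and K look, so those in the image of e integrate freely. *)
Lemma sum_kernel_block (K K' : {ffun A -> T} -> A -> T -> R) (Phi : {ffun A -> T} -> R)
    (G : {ffun I -> T} -> R) :
  (forall y y' : {ffun A -> T}, (forall a, a \notin codom e -> y a = y' a) ->
     [/\ K y = K y', K' y = K' y' & Phi y = Phi y']) ->
  (forall (y : {ffun A -> T}) a, \sum_t K' y a t = 1) ->
  (forall (y : {ffun A -> T}) a, a \notin codom e -> K y a = K' y a) ->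
  \sum_(y : {ffun A -> T}) (\prod_a K y a (y a)) * (Phi y * G [ffun i => y (e i)]) =
  \sum_(y : {ffun A -> T}) (\prod_a K' y a (y a)) *
    (Phi y * \sum_(z : {ffun I -> T}) (\prod_i K y (e i) (z i)) * G z).
Proof.
move=> loc K'1 KK'.
have [glue [gluel [gluer ->]]] :=
  sum_ffun_split (fun y => (\prod_a K y a (y a)) * (Phi y * G [ffun i => y (e i)])).
have [glue' [gluel' [gluer' ->]]] := sum_ffun_split (fun y => (\prod_a K' y a (y a)) *
    (Phi y * \sum_(z : {ffun I -> T}) (\prod_i K y (e i) (z i)) * G z)).
(* Both splittings prescribe the same values on the image of [e] and off it, so one [glue] serves
   both sides. *)
have <- : glue = glue'.
  apply/funext => f; apply/funext => g; apply/ffunP => a.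
  have [h' hK h'K] := h_bij; rewrite -[a]h'K.
  by case: (h' a) => [i|j] /=; rewrite ?gluel ?gluel' ?gluer ?gluer'.
apply: eq_bigr => g _.
(* [f0] is a reference filling of the block, at which the kernels and [Phi] are evaluated; without
   any filling both sums are empty. *)
have [f0 _|noF] := pickP (xpredT : pred {ffun I -> T}); last first.
  by rewrite !big1 // => f; have := noF f.
have out f : forall a, a \notin codom e -> glue f g a = glue f0 g a.
  by move=> a aP; rewrite -[a]/(val (exist _ a aP : J)) !gluer.
pose y0 := glue f0 g.
transitivity ((\prod_(j : J) K y0 (val j) (g j)) * Phi y0 *
    \sum_(f : {ffun I -> T}) (\prod_i K y0 (e i) (f i)) * G f).
  rewrite big_distrr /=; apply: eq_bigr => f _.
  have [-> _ ->] := loc _ _ (out f); rewrite prod_split.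
  have -> : [ffun i => glue f g (e i)] = f by apply/ffunP => i; rewrite ffunE gluel.
  under eq_bigr do rewrite gluel.
  under [X in _ * X * _]eq_bigr do rewrite gluer.
  by rewrite [X in X * _]mulrC mulrACA.
have K'sum1 : \sum_(f : {ffun I -> T}) (\prod_i K' y0 (e i) (f i)) = 1.
  rewrite -(bigA_distr_bigA (fun i t => K' y0 (e i) t)) big1 // => i _; exact: K'1.
(* The block has total [K']-mass 1; inserting this factor turns the common value into the right-hand
   sum. *)
set L := (LHS); rewrite -[L]mul1r -[X in X * L]K'sum1 big_distrl /= {}/L.
apply: eq_bigr => f _.
have [-> -> ->] := loc _ _ (out f). rewrite prod_split.
under [X in X * _ = _]eq_bigr do rewrite -(gluel f g).
have -> : \prod_(j : J) K y0 (val j) (g j) = \prod_(j : J) K' y0 (val j) (glue f g (val j)).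
  by apply: eq_bigr => j _; rewrite gluer (KK' y0) //; case: j.
by rewrite !mulrA.
Qed.

End Fubini.

Lemma prod_dist_sum1 (R : realType) (A T : finType) (p : A -> T -> R) :
  (forall a, \sum_t p a t = 1) -> \sum_(f : {ffun A -> T}) \prod_a p a (f a) = 1.
Proof. by move=> p1; rewrite -bigA_distr_bigA big1. Qed.

Lemma sum_marginal (R : realType) (A I T : finType) (e : I -> A)
    (p : A -> T -> R) (G : {ffun I -> T} -> R) :
  injective e -> (forall a, \sum_t p a t = 1) ->
  \sum_(f : {ffun A -> T}) (\prod_a p a (f a)) * G [ffun i => f (e i)] =
  \sum_(g : {ffun I -> T}) (\prod_i p (e i) (g i)) * G g.
Proof.
move=> e_inj p1.
have := @sum_kernel_block R A I T e e_inj (fun=> p) (fun=> p) (fun=> 1) G.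
under eq_bigr do rewrite mul1r.
move=> -> //; under eq_bigr do rewrite mul1r.
by rewrite -big_distrl /= prod_dist_sum1 // mul1r.
Qed.

(** * The random coding bound *)

(** Given the codeword of [w], the others are still i.i.d., so an error has conditional probability
    at most 1 and, by the union bound, at most [M - 1] times the pairwise one. Ties count as errors.
    Scores live in any ordered type, as information densities may be [-oo]. *)
Lemma random_coding (R : realType) (d : Order.disp_t) (V : orderType d) (Z : finType)
    (M : nat) (P : Z -> R) (sc : Z -> V) (w : 'I_M) :
  is_dist P -> 
  forall F : Z -> R, (forall z, 0 <= F z) ->
  \sum_(C : {ffun 'I_M -> Z}) (\prod_v P (C v)) *
    (F (C w) * [exists v, (v != w) && (sc (C w) <= sc (C v))%O]%:R)
  <= \sum_x P x * (F x * Num.min 1 ((M%:R - 1) * \sum_xb P xb * (sc x <= sc xb)%O%:R)).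
Proof.
move=> [P_ge0 P1] F F_ge0.
pose err (C : {ffun 'I_M -> Z}) := [exists v, (v != w) && (sc (C w) <= sc (C v))%O].
rewrite (eq_bigr (fun C : {ffun 'I_M -> Z} => (\prod_v P (C v)) * (F (C w) * (err C)%:R))) //.
rewrite (partition_big (fun C : {ffun 'I_M -> Z} => C w) xpredT) //=.
apply: ler_sum => x _.
have PC_ge0 (C : {ffun 'I_M -> Z}) : 0 <= \prod_v P (C v) by apply: prodr_ge0.
have -> : \sum_(C : {ffun 'I_M -> Z} | C w == x)
      (\prod_v P (C v)) * (F (C w) * (err C)%:R) =
    F x * \sum_(C : {ffun 'I_M -> Z} | C w == x) (\prod_v P (C v)) * (err C)%:R.
  by rewrite big_distrr; apply: eq_bigr => C /eqP ->; rewrite mulrCA.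
rewrite mulrCA ler_wpM2l //.
(* The factor [q w] also tests that the [w]-th codeword is [x], so that the constrained sums factor
   over messages. *)
pose q v z : R := P z * ((v == w) ==> (z == x))%:R.
have prodq (h : Z -> R) v : v != w ->
    \sum_(C : {ffun 'I_M -> Z} | C w == x) (\prod_u P (C u)) * h (C v) =
    P x * \sum_z P z * h z.
  move=> vw; pose r u z : R := q u z * (if u == v then h z else 1).
  transitivity (\sum_(C : {ffun 'I_M -> Z}) \prod_u r u (C u)).
    rewrite big_mkcond; apply: eq_bigr => C _; rewrite !big_split /=.
    rewrite [X in _ = _ * X](bigD1 v) //= eqxx.
    rewrite [X in _ = _ * (_ * X)]big1 ?mulr1; last by move=> u /negPf ->.
    rewrite [X in _ = _ * X * _](bigD1 w) //= eqxx /=.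
    rewrite [X in _ = _ * (_ * X) * _]big1 ?mulr1; last by move=> u /negPf ->.
    by case: eqP; rewrite ?mulr1 // mulr0 mul0r.
  rewrite -bigA_distr_bigA (bigD1 w) //= [X in _ * X](bigD1 v) //=.
  rewrite [X in _ * (_ * X)]big1 ?mulr1.
    congr (_ * _).
      rewrite (bigD1 x) //= /r /q !eqxx (eq_sym w) (negPf vw) /= !mulr1.
      by rewrite big1 ?addr0 // => z /negPf ->; rewrite !mulr0 mul0r.
    by apply: eq_bigr => z _; rewrite /r /q eqxx (negPf vw) /= mulr1.
  move=> u /andP[uw uv]; rewrite -[RHS]P1; apply: eq_bigr => z _.
  by rewrite /r /q (negPf uw) (negPf uv) /= !mulr1.
(* The two entries of the minimum: the total mass [P x], then the union bound. *)
rewrite minr_pMr // mulr1 le_min; apply/andP; split.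
  have -> : P x = \sum_(C : {ffun 'I_M -> Z} | C w == x) \prod_u P (C u).
    transitivity (\sum_(C : {ffun 'I_M -> Z}) \prod_u q u (C u)).
      rewrite -bigA_distr_bigA (bigD1 w) //= [X in _ * X]big1 ?mulr1.
        rewrite (bigD1 x) //= /q !eqxx mulr1 big1 ?addr0 // => z /negPf ->.
        by rewrite mulr0.
      move=> u /negPf uw; rewrite -[RHS]P1; apply: eq_bigr => z _.
      by rewrite /q uw mulr1.
    rewrite [RHS]big_mkcond; apply: eq_bigr => C _; rewrite big_split /=.
    rewrite [X in _ * X](bigD1 w) //= eqxx [X in _ * (_ * X)]big1; last by move=> u /negPf ->.
    by case: eqP; rewrite /= ?mulr1 ?mul1r ?mulr0 ?mul0r.
  by apply: ler_sum => C _; rewrite ler_piMr // lern1; case: (err C).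
apply: (@le_trans _ _ (\sum_(C : {ffun 'I_M -> Z} | C w == x)
   (\prod_u P (C u)) * \sum_(v | v != w) (sc x <= sc (C v))%O%:R)).
  apply: ler_sum => C /eqP Cw; rewrite ler_wpM2l //.
  rewrite /err; case: existsP => [[v /andP[vw le]]|_] /=; last by apply: sumr_ge0.
  by rewrite (bigD1 v) //= -Cw le lerDl sumr_ge0.
under [leLHS]eq_bigr do rewrite mulr_sumr.
rewrite exchange_big /=.
rewrite (eq_bigr (fun=> P x * \sum_z P z * (sc x <= sc z)%O%:R)); last first.
  by move=> v vw; rewrite (prodq (fun z => (sc x <= sc z)%O%:R)).
rewrite sumr_const -[leLHS]mulr_natl mulrCA ler_wpM2l // ler_wpM2r //.
  by apply: sumr_ge0 => z _; apply: mulr_ge0.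
have := cardC1 w; rewrite card_ord => cw.
have M0 : (0 < M)%N by apply: leq_ltn_trans (ltn_ord w).
by rewrite (eq_card (_ : _ =i predC1 w)) // cw -subn1 natrB.
Qed.

(** * The coding scheme over an abstract schedule *)

Section Scheme.
Variables (R : realType) (X Y : finType) (W : X -> Y -> R) (PX : X -> R) (xA xR : X).
(* ctl t is None at a data time and Some i in the i-th control block, which
   cemb i enumerates; demb j enumerates the data times used by the j-th
   estimate; T i z is the probability that the i-th test accepts output z. *)
Variables (M N k : nat) (ctl : nat -> option nat).
Variables (m : nat -> nat) (cemb : forall i, 'I_(m i) -> 'I_N).
Variables (sz : nat -> nat) (demb : forall j, 'I_(sz j) -> 'I_N).
Variables (T : forall i, {ffun 'I_(m i) -> Y} -> R) (w0 : 'I_M).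
Hypotheses (W_channel : is_channel W) (PX_dist : is_dist PX).
Hypothesis cemb_inj : forall i, injective (@cemb i).
Hypothesis ctl_cemb : forall i s, ctl (@cemb i s) = Some i.
Hypothesis demb_inj : forall j, injective (@demb j).
Hypothesis ctl_demb : forall j s, ctl (@demb j s) = None.
Hypothesis T01 : forall i z, 0 <= @T i z <= 1.

Local Notation book := {ffun 'I_M -> {ffun 'I_N -> X}}.
Local Notation out := {ffun 'I_N -> Y}.

(** * Estimates and the feedback-dependent output law *)

Definition max_dens_dec (m' : nat) (C : 'I_M -> {ffun 'I_m' -> X})
    (y : {ffun 'I_m' -> Y}) : 'I_M :=
  [arg max_(v > w0) info_dens W PX (C v) y]%O.

Definition estimate (j : nat) (C : book) (y : out) : 'I_M :=
  max_dens_dec (fun v => [ffun s => C v (@demb j s)]) [ffun s => y (@demb j s)].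

Definition chan_input (C : book) (w : 'I_M) (y : out) (t : 'I_N) : X :=
  if ctl t is Some i then if estimate i C y == w then xA else xR else C w t.

Definition out_prob (C : book) (w : 'I_M) (y : out) : R := \prod_t W (chan_input C w y t) (y t).

Definition ctl_outputs (i : nat) (y : out) : {ffun 'I_(m i) -> Y} := [ffun s => y (@cemb i s)].

Definition test_mean (i : nat) (e : bool) (G : {ffun 'I_(m i) -> Y} -> R) : R :=
  \sum_z prod_dist (m i) (W (if e then xA else xR)) z * G z.

Definition data_only (Phi : out -> R) :=
  forall y y' : out, (forall t : 'I_N, ctl t = None -> y t = y' t) -> Phi y = Phi y'.

Lemma W_ge0 x y : 0 <= W x y. Proof. by case: (W_channel x). Qed.
Lemma W_sum1 x : \sum_y W x y = 1. Proof. by case: (W_channel x). Qed.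

Lemma out_prob_ge0 C w y : 0 <= out_prob C w y.
Proof. by apply: prodr_ge0 => t _; exact: W_ge0. Qed.

Lemma estimate_local j C (y y' : out) :
  (forall s, y (@demb j s) = y' (@demb j s)) -> estimate j C y = estimate j C y'.
Proof.
by move=> yy'; rewrite /estimate; congr max_dens_dec; apply/ffunP => s; rewrite !ffunE.
Qed.

Lemma estimate_data j C (y y' : out) :
  (forall t : 'I_N, ctl t = None -> y t = y' t) -> estimate j C y = estimate j C y'.
Proof. by move=> yy'; apply: estimate_local => s; apply: yy'; exact: ctl_demb. Qed.

Lemma chan_input_data C w (y y' : out) :
  (forall t : 'I_N, ctl t = None -> y t = y' t) -> chan_input C w y = chan_input C w y'.
Proof.
move=> yy'; apply/funext => t; rewrite /chan_input.
by case: (ctl t) => // i; rewrite (@estimate_data i C y y').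
Qed.

Lemma off_block_data i (y y' : out) :
  (forall a, a \notin codom (@cemb i) -> y a = y' a) ->
  forall t : 'I_N, ctl t = None -> y t = y' t.
Proof.
move=> yy' t tN; apply: yy'; apply/codomP => -[s ts].
by rewrite ts ctl_cemb in tN.
Qed.

(** Estimates read data outputs only, so given the outputs outside the block its input is constantly
    [xA] or [xR], and its outputs are i.i.d. and can be summed out. *)
Lemma sum_out_prob_block i C w (Phi : out -> R) (G : {ffun 'I_(m i) -> Y} -> R) :
  (forall y y' : out, (forall a, a \notin codom (@cemb i) -> y a = y' a) -> Phi y = Phi y') ->
  \sum_y out_prob C w y * (Phi y * G (ctl_outputs i y)) =
  \sum_y out_prob C w y * (Phi y * test_mean (estimate i C y == w) G).
Proof.
move=> Phi_loc.
rewrite (sum_kernel_block (@cemb_inj i) (K := fun y t => W (chan_input C w y t))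
  (K' := fun y t => W (chan_input C w y t))) //.
- apply: eq_bigr => y _; congr (_ * (_ * _)); apply: eq_bigr => z _.
  by congr (_ * _); apply: eq_bigr => s _; rewrite /chan_input ctl_cemb.
- move=> y y' yy'; have yd := off_block_data yy'.
  by rewrite (chan_input_data C w yd); split=> //; apply: Phi_loc.
- move=> y a; exact: W_sum1.
Qed.

(** Blocks are removed from the last one down: each mean left behind depends on data outputs only
    and is absorbed into [Phi], which is therefore general in the induction. *)
Lemma sum_out_prob_blocks C w (G : forall i, {ffun 'I_(m i) -> Y} -> R) j (Phi : out -> R) :
  data_only Phi ->
  \sum_y out_prob C w y * (Phi y * \prod_(1 <= i < j) G i (ctl_outputs i y)) =
  \sum_y out_prob C w y * (Phi y * \prod_(1 <= i < j) test_mean (estimate i C y == w) (G i)).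
Proof.
elim: j Phi => [|[|j] IHj] Phi Phi_data.
- by apply: eq_bigr => y _; rewrite !big_geq.
- by apply: eq_bigr => y _; rewrite !big_geq.
under eq_bigr do rewrite big_nat_recr //= [X in _ * X]mulrA.
rewrite [LHS](@sum_out_prob_block j.+1 C w
  (fun y => Phi y * \prod_(1 <= i < j.+1) G i (ctl_outputs i y)) (G j.+1)).
  under eq_bigr do rewrite [X in _ * X]mulrAC.
  rewrite [LHS](IHj (fun y => Phi y * test_mean (estimate j.+1 C y == w) (G j.+1))).
    apply: eq_bigr => y _; rewrite [X in _ = _ * (_ * X)]big_nat_recr //=.
    by rewrite -!mulrA [X in _ = _ * (_ * X)]mulrC.
  by move=> y y' yy'; rewrite (Phi_data _ _ yy') (estimate_data j.+1 C yy').
move=> y y' yy'; congr (_ * _); first by apply: Phi_data; exact: off_block_data yy'.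
apply: eq_big_nat => i /andP[_ ij]; congr G; apply/ffunP => s; rewrite !ffunE.
(* Distinct blocks are disjoint because [ctl] determines the block of a position. *)
apply: yy'; apply/codomP => -[s' /(congr1 (fun t : 'I_N => ctl t))].
by rewrite !ctl_cemb => -[ij']; rewrite ij' ltnn in ij.
Qed.

(** Control outputs have total mass 1 under any input, so a function of the data outputs cannot
    distinguish the adaptive law from sending the codeword throughout. *)
Lemma sum_out_prob_data C w (Phi : out -> R) : data_only Phi ->
  \sum_y out_prob C w y * Phi y = \sum_(y : out) (\prod_t W (C w t) (y t)) * Phi y.
Proof.
move=> Phi_data; pose J := {t : 'I_N | ctl t != None}.
have := @sum_kernel_block R _ J Y val val_inj (fun y t => W (chan_input C w y t))
  (fun y t => W (C w t)) Phi (fun=> 1).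
under eq_bigr do rewrite mulr1.
move=> ->.
- apply: eq_bigr => y _; congr (_ * _); rewrite -[RHS]mulr1; congr (_ * _).
  under eq_bigr do rewrite mulr1.
  by rewrite (prod_dist_sum1 (p := fun (a : J) => W (chan_input C w y (val a)))) // => a; exact: W_sum1.
- move=> y y' yy'; have yd (t : 'I_N) : ctl t = None -> y t = y' t.
    move=> tN; apply: yy'; apply/codomP => -[s ts].
    by have := valP s; rewrite -ts tN.
  by rewrite (chan_input_data C w yd) (Phi_data _ _ yd).
- move=> y a; exact: W_sum1.
- move=> y a aN; congr W; rewrite /chan_input; case E: (ctl a) => [i|] //.
  have aP : ctl a != None by rewrite E.
  by have := codom_f val (exist _ a aP : J); rewrite /= (negPf aN).
Qed.

Lemma sum_out_prob1 C w : \sum_y out_prob C w y = 1.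
Proof.
have := @sum_out_prob_data C w (fun=> 1) (fun _ _ _ => erefl).
under eq_bigr do rewrite mulr1.
move=> ->; under eq_bigr do rewrite mulr1.
by apply: (prod_dist_sum1 (p := fun t => W (C w t))) => t; exact: W_sum1.
Qed.

(** * The random codebook and the error of each estimate *)

(** Codewords span the whole horizon [N], so that every estimate reads the same book through a
    projection to its data times. *)
Definition book_prob (C : book) : R := \prod_v prod_dist N PX (C v).

Lemma prod_dist_is_dist (U : finType) (p : U -> R) n : is_dist p -> is_dist (prod_dist n p).
Proof.
move=> [p_ge0 p1]; split=> [t|]; first by apply: prodr_ge0.
exact: (prod_dist_sum1 (p := fun=> p)).
Qed.

Lemma book_prob_is_dist : is_dist book_prob.
Proof.
have [P_ge0 P1] := prod_dist_is_dist N PX_dist.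
split=> [C|]; first by apply: prodr_ge0.
exact: (prod_dist_sum1 (p := fun=> prod_dist N PX)).
Qed.

Lemma max_dens_dec_neq m' (C : 'I_M -> {ffun 'I_m' -> X}) y w :
  max_dens_dec C y != w ->
  [exists v, (v != w) && (info_dens W PX (C w) y <= info_dens W PX (C v) y)%O].
Proof.
rewrite /max_dens_dec; case: arg_maxP => // v _ vmax vw.
by apply/existsP; exists v; rewrite vw /=; apply: vmax.
Qed.

Lemma mean_err_rcu j w :
  \sum_C book_prob C * (\sum_y out_prob C w y * (estimate j C y != w)%:R) <= rcu W PX (sz j) M.
Proof.
pose pr (x : {ffun 'I_N -> X}) : {ffun 'I_(sz j) -> X} := [ffun s => x (@demb j s)].
have PXN := prod_dist_is_dist N PX_dist.
have chan_ge0 n x y : 0 <= chan_n W (m := n) x y.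
  by apply: prodr_ge0 => s _; exact: W_ge0.
have -> : \sum_C book_prob C * (\sum_y out_prob C w y * (estimate j C y != w)%:R) =
    \sum_y \sum_C book_prob C *
      (chan_n W (pr (C w)) y * (max_dens_dec (fun v => pr (C v)) y != w)%:R).
  rewrite exchange_big; apply: eq_bigr => C _; rewrite -mulr_sumr; congr (_ * _).
  rewrite sum_out_prob_data; last by move=> y y' /(estimate_data j C) ->.
  rewrite (sum_marginal (p := fun t => W (C w t))
    (fun y => (max_dens_dec (fun v => pr (C v)) y != w)%:R) (@demb_inj j)) //; last first.
    by move=> t; exact: W_sum1.
  by apply: eq_bigr => y _; congr (_ * _); apply: eq_bigr => s _; rewrite ffunE.
rewrite /rcu [leRHS]exchange_big /=; apply: ler_sum => y _.
(* For a fixed output [y] the score is the density of the projected codeword and the weight is its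
   likelihood. *)
have := random_coding (fun x => info_dens W PX (pr x) y) w PXN
   (fun x => chan_ge0 _ (pr x) y).
set B := (X in _ <= X -> _) => leB; apply: (@le_trans _ _ B).
  apply: le_trans leB; apply: ler_sum => C _.
  rewrite ler_wpM2l ?(proj1 book_prob_is_dist) // ler_wpM2l //.
  by rewrite ler_nat; case: (boolP (max_dens_dec _ _ != w)) => // /max_dens_dec_neq ->.
rewrite le_eqVlt; apply/orP; left; apply/eqP; rewrite /B {leB B}.
(* Full-length codewords marginalise to the data times, for the sent codeword and for its
   competitor. *)
have marg (G : {ffun 'I_(sz j) -> X} -> R) :
    \sum_x prod_dist N PX x * G (pr x) = \sum_x prod_dist (sz j) PX x * G x.
  by apply: (sum_marginal (p := fun=> PX)) => [|_]; [exact: demb_inj | exact: PX_dist.2].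
pose h (x : {ffun 'I_(sz j) -> X}) := chan_n W x y * Num.min 1 ((M%:R - 1) *
  \sum_xb prod_dist (sz j) PX xb * ((info_dens W PX x y <= info_dens W PX xb y)%E)%:R).
transitivity (\sum_x prod_dist (sz j) PX x * h x); last first.
  by apply: eq_bigr => x _; rewrite /h mulrA.
rewrite -marg; apply: eq_bigr => x _; congr (_ * (_ * Num.min 1 (_ * _))).
exact: (marg (fun xb => (info_dens W PX (pr x) y <= info_dens W PX xb y)%E%:R)).
Qed.


(* The common randomness holds one biased coin for every block and every output
   of that block: the test reads the coin attached to the output it observes. *)
Definition coin_index := {o : 'I_k.+1 & {ffun 'I_(m o) -> Y}}.
Definition coin_at (i : nat) (y : out) : coin_index :=
  Tagged (fun o : 'I_k.+1 => {ffun 'I_(m o) -> Y}) (ctl_outputs (inord i : 'I_k.+1) y).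
Definition coin_prob (z : coin_index) (b : bool) : R :=
  if b then T (tagged z) else 1 - T (tagged z).
Definition coins_prob (b : {ffun coin_index -> bool}) : R := \prod_z coin_prob z (b z).
Definition accepts (i : nat) (b : {ffun coin_index -> bool}) (y : out) : bool :=
  b (coin_at i y).

Definition accept_prob (i : nat) (e : bool) : R := test_mean e (@T i).

Lemma coin_prob_sum1 z : \sum_b coin_prob z b = 1.
Proof. by rewrite big_bool /= addrC subrK. Qed.

Lemma coins_prob_is_dist : is_dist coins_prob.
Proof.
split=> [b|]; last exact: (prod_dist_sum1 coin_prob_sum1).
apply: prodr_ge0 => z _; have /andP[T0 T1] := T01 (tagged z).
by rewrite /coin_prob; case: (b z); rewrite ?subr_ge0.
Qed.

(** For fixed outputs, distinct blocks read distinct coins since the block number is part of the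
    index, so the coins read are independent. [inord] is the identity on the blocks [1] to [k]. *)
Lemma coin_avg (h : nat -> bool -> R) y :
  \sum_b coins_prob b * \prod_(1 <= i < k.+1) h i (accepts i b y) =
  \prod_(1 <= i < k.+1)
    (T (ctl_outputs i y) * h i true + (1 - T (ctl_outputs i y)) * h i false).
Proof.
rewrite big_add1 big_mkord /=; pose e (i : 'I_k) := coin_at i.+1 y.
have e_inj : injective e.
  move=> i j /(congr1 tag) /= /(congr1 val) /=.
  by rewrite !inordK ?ltnS // => -[] /val_inj.
pose H (g : {ffun 'I_k -> bool}) := \prod_(i < k) h i.+1 (g i).
transitivity (\sum_(b : {ffun coin_index -> bool}) (\prod_z coin_prob z (b z)) *
    H [ffun i => b (e i)]).
  apply: eq_bigr => b _; congr (_ * _); rewrite big_add1 big_mkord.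
  by apply: eq_bigr => i _; rewrite ffunE.
rewrite (sum_marginal H e_inj coin_prob_sum1) /H.
under [LHS]eq_bigr do rewrite -big_split /=.
rewrite -(bigA_distr_bigA (fun i t => coin_prob (e i) t * h i.+1 t)).
apply: eq_bigr => i _; rewrite big_bool /coin_prob /=.
by rewrite inordK // ltnS.
Qed.

Lemma test_mean_ge0 i e (G : {ffun 'I_(m i) -> Y} -> R) :
  (forall z, 0 <= G z) -> 0 <= test_mean e G.
Proof.
move=> G0; apply: sumr_ge0 => z _; apply: mulr_ge0 => //.
by apply: prodr_ge0 => s _; exact: W_ge0.
Qed.

Lemma test_mean_mix i e (a b : R) :
  test_mean e (fun z => @T i z * a + (1 - T z) * b) =
    accept_prob i e * a + (1 - accept_prob i e) * b.
Proof.
have [_ P1] := prod_dist_is_dist (m i) (W_channel (if e then xA else xR)).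
rewrite -[X in (X - _) * b]P1 /accept_prob /test_mean -sumrB !mulr_suml -big_split /=.
by apply: eq_bigr => z _; ring.
Qed.

Lemma accept_prob01 i e : 0 <= accept_prob i e <= 1.
Proof.
rewrite test_mean_ge0; last by move=> z; case/andP: (T01 z).
have [P0 P1] := prod_dist_is_dist (m i) (W_channel (if e then xA else xR)).
rewrite -[leRHS]P1; apply: ler_sum => z _.
by rewrite ler_piMr //; case/andP: (T01 z).
Qed.

(** * Averages over the ensemble *)

Definition expect (F : book -> {ffun coin_index -> bool} -> 'I_M -> out -> R) : R :=
  \sum_C \sum_b book_prob C * coins_prob b * \sum_w M%:R^-1 * \sum_y out_prob C w y * F C b w y.

(** The message is summed outermost here, so that [mean_err_rcu] applies to each message; [expect]
    follows the order of the code. *)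
Definition data_expect (F : book -> 'I_M -> out -> R) : R :=
  \sum_w M%:R^-1 * \sum_C book_prob C * \sum_y out_prob C w y * F C w y.

Lemma expectZ a F : expect (fun C b w y => a * F C b w y) = a * expect F.
Proof.
rewrite [RHS]mulr_sumr; apply: eq_bigr => C _.
rewrite [RHS]mulr_sumr; apply: eq_bigr => b _.
rewrite [RHS]mulrCA; congr (_ * _).
rewrite [RHS]mulr_sumr; apply: eq_bigr => w _.
rewrite [RHS]mulrCA; congr (_ * _).
by rewrite [RHS]mulr_sumr; apply: eq_bigr => y _; rewrite mulrCA.
Qed.

Lemma expectD F G :
  expect (fun C b w y => F C b w y + G C b w y) = expect F + expect G.
Proof.
rewrite -big_split /=; apply: eq_bigr => C _; rewrite -big_split /=.
apply: eq_bigr => b _; rewrite -mulrDr -big_split /=; congr (_ * _).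
apply: eq_bigr => w _; rewrite -mulrDr -big_split /=; congr (_ * _).
by apply: eq_bigr => y _; rewrite mulrDr.
Qed.

Lemma expect_sum (I : Type) (r : seq I)
    (F : I -> book -> {ffun coin_index -> bool} -> 'I_M -> out -> R) :
  expect (fun C b w y => \sum_(i <- r) F i C b w y) = \sum_(i <- r) expect (F i).
Proof.
elim: r => [|i r IHr].
  rewrite big_nil -[RHS](mul0r (expect (fun _ _ _ _ => 0))) -expectZ.
  by congr expect; apply/funext => C; apply/funext => b; apply/funext => w;
    apply/funext => y; rewrite big_nil mul0r.
rewrite big_cons -IHr -expectD.
by congr expect; apply/funext => C; apply/funext => b; apply/funext => w;
  apply/funext => y; rewrite big_cons.
Qed.

(** * Stopping events as products over blocks *)

(** A value [j] below [k] means first acceptance in block [j.+1]; [find] returns [k] when every test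
    rejects. *)
Definition stop_block (b : {ffun coin_index -> bool}) (y : out) : nat :=
  find (fun i => accepts i.+1 b y) (iota 0 k).

Lemma stop_block_le b y : (stop_block b y <= k)%N.
Proof. by rewrite /stop_block -[leqRHS](size_iota 0) find_size. Qed.

Lemma not_accepts_before_stop i b y : (i < stop_block b y)%N -> accepts i.+1 b y = false.
Proof.
move=> iJ; have := before_find 0%N iJ.
by rewrite nth_iota ?add0n // (leq_trans iJ) // stop_block_le.
Qed.

Lemma accepts_stop_block b y : (stop_block b y < k)%N -> accepts (stop_block b y).+1 b y.
Proof.
move=> Jk; have := @nth_find _ 0%N (fun i => accepts i.+1 b y) (iota 0 k).
by rewrite has_find size_iota => /(_ Jk); rewrite nth_iota.
Qed.

Lemma prod_reject j b y : (j <= k)%N ->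
  \prod_(1 <= i < j.+1) (~~ accepts i b y)%:R = (j <= stop_block b y)%N%:R :> R.
Proof.
elim: j => [_|j IHj jk]; first by rewrite big_geq.
rewrite big_nat_recr //= (IHj (ltnW jk)).
case: (ltngtP j (stop_block b y)) => [ltj|_|eqj]; last 1 first.
- by rewrite eqj accepts_stop_block -?eqj // mulr0.
- by rewrite (not_accepts_before_stop ltj) mulr1.
- by rewrite mul0r.
Qed.

Lemma prod_accept j b y : (1 <= j <= k)%N ->
  (\prod_(1 <= i < j) (~~ accepts i b y)%:R) * (accepts j b y)%:R =
    ((stop_block b y).+1 == j)%:R :> R.
Proof.
case: j => [//|j] /= jk; rewrite (prod_reject _ _ (ltnW jk)) eqSS.
case: (ltngtP j (stop_block b y)) => [ltj|_|eqj]; last 1 first.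
- by rewrite eqj accepts_stop_block -?eqj // mulr1.
- by rewrite (not_accepts_before_stop ltj) mulr0.
- by rewrite mul0r.
Qed.

Lemma data_expect_le F G :
  (forall C w y, F C w y <= G C w y) -> data_expect F <= data_expect G.
Proof.
move=> FG; apply: ler_sum => w _; rewrite ler_wpM2l ?invr_ge0 //.
apply: ler_sum => C _; rewrite ler_wpM2l ?(proj1 book_prob_is_dist) //.
by apply: ler_sum => y _; rewrite ler_wpM2l ?out_prob_ge0.
Qed.

Lemma data_expectZ a F : data_expect (fun C w y => a * F C w y) = a * data_expect F.
Proof.
rewrite mulr_sumr; apply: eq_bigr => w _; rewrite mulrCA; congr (_ * _).
rewrite mulr_sumr; apply: eq_bigr => C _; rewrite mulrCA; congr (_ * _).
by rewrite mulr_sumr; apply: eq_bigr => y _; rewrite mulrCA.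
Qed.

Lemma data_expectD F G :
  data_expect (fun C w y => F C w y + G C w y) = data_expect F + data_expect G.
Proof.
rewrite -big_split /=; apply: eq_bigr => w _; rewrite -mulrDr; congr (_ * _).
rewrite -big_split /=; apply: eq_bigr => C _; rewrite -mulrDr; congr (_ * _).
by rewrite -big_split /=; apply: eq_bigr => y _; rewrite -mulrDr.
Qed.

Let M_gt0 : (0 < M)%N. Proof. exact: leq_ltn_trans (ltn_ord w0). Qed.
Let M_neq0 : M%:R != 0 :> R. Proof. by rewrite pnatr_eq0 -lt0n. Qed.

Lemma data_expect1 : data_expect (fun _ _ _ => 1) = 1.
Proof.
rewrite /data_expect; under eq_bigr => w _.
  under eq_bigr => C _ do [under eq_bigr do rewrite mulr1; rewrite sum_out_prob1 mulr1].
  rewrite (proj2 book_prob_is_dist) mulr1; over.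
by rewrite sumr_const card_ord -[LHS]mulr_natr mulVf.
Qed.

Lemma expect1 : expect (fun _ _ _ _ => 1) = 1.
Proof.
rewrite /expect; under eq_bigr => C _.
  under eq_bigr => b _.
    under eq_bigr => w _ do [under eq_bigr do rewrite mulr1; rewrite sum_out_prob1 mulr1].
    rewrite sumr_const card_ord -[X in _ * X]mulr_natr mulVf // mulr1; over.
  rewrite -mulr_sumr (proj2 coins_prob_is_dist) mulr1; over.
exact: (proj2 book_prob_is_dist).
Qed.

Lemma data_expect_err j :
  data_expect (fun C w y => (estimate j C y != w)%:R) <= rcu W PX (sz j) M.
Proof.
apply: (@le_trans _ _ (\sum_(w < M) M%:R^-1 * rcu W PX (sz j) M)).
  by apply: ler_sum => w _; rewrite ler_wpM2l ?invr_ge0 // mean_err_rcu.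
by rewrite sumr_const card_ord -[leLHS]mulr_natr mulrAC mulVf ?mul1r.
Qed.

(** Averaging the coins replaces each verdict by a function of its block outputs; the control blocks
    are then summed out, leaving factors that see the data only through the correctness of the
    estimates. *)
Lemma expect_factor (Phi : book -> 'I_M -> out -> R) (h : nat -> bool -> R) :
  (forall C w, data_only (Phi C w)) ->
  expect (fun C b w y => Phi C w y * \prod_(1 <= i < k.+1) h i (accepts i b y)) =
  data_expect (fun C w y => Phi C w y * \prod_(1 <= i < k.+1)
    (accept_prob i (estimate i C y == w) * h i true +
     (1 - accept_prob i (estimate i C y == w)) * h i false)).
Proof.
move=> Phi_data; rewrite /data_expect.
under [RHS]eq_bigr do rewrite mulr_sumr.
rewrite [RHS]exchange_big; apply: eq_bigr => C _.
under [LHS]eq_bigr do rewrite mulr_sumr.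
rewrite exchange_big; apply: eq_bigr => w _.
under [LHS]eq_bigr do rewrite mulrACA.
rewrite -mulr_sumr [X in X * _ = _]mulrC -mulrA; congr (_ * (_ * _)).
under [LHS]eq_bigr do rewrite mulr_sumr.
rewrite exchange_big /=.
pose G i (z : {ffun 'I_(m i) -> Y}) := @T i z * h i true + (1 - T z) * h i false.
transitivity (\sum_y out_prob C w y *
    (Phi C w y * \prod_(1 <= i < k.+1) test_mean (estimate i C y == w) (@G i))); last first.
  apply: eq_bigr => y _; congr (_ * (_ * _)); apply: eq_bigr => i _.
  exact: test_mean_mix.
rewrite -(sum_out_prob_blocks C w G) //.
apply: eq_bigr => y _; rewrite -coin_avg !mulr_sumr.
by apply: eq_bigr => b _; rewrite mulrCA [X in _ * X]mulrCA.
Qed.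

Lemma prod_nat_upto (j : nat) (A : nat -> R) (B : R) : (1 <= j <= k)%N ->
  \prod_(1 <= i < k.+1) (if (i < j)%N then A i else if i == j then B else 1) =
  (\prod_(1 <= i < j) A i) * B.
Proof.
move=> /andP[j1 jk]; rewrite (big_cat_nat (n := j)) //=; last exact: leqW.
congr (_ * _); first by apply: eq_big_nat => i /andP[_ ->].
rewrite big_ltn // ltnn eqxx big_nat big1 ?mulr1 // => i /andP[ji _].
by rewrite ltnNge (ltnW ji) gtn_eqF.
Qed.

(** * Bounds for each stage *)

Variables (p : nat -> R).
Hypothesis rej_le_p : forall i e, (1 <= i <= k)%N -> 1 - accept_prob i e <= p i.

(** Blocks before [j] reject with probability at most [p i] whether or not their estimates are
    right, and blocks after [j] average to 1. Block [j] is kept exact, since [Phi] may depend on the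
    correctness of its estimate. *)
Lemma expect_stage_le (j : nat) (Phi : book -> 'I_M -> out -> R) (h : bool -> R) :
  (1 <= j <= k)%N -> (forall C w, data_only (Phi C w)) ->
  (forall C w y, 0 <= Phi C w y) -> (forall b, 0 <= h b) ->
  expect (fun C b w y =>
    Phi C w y * ((\prod_(1 <= i < j) (~~ accepts i b y)%:R) * h (accepts j b y))) <=
  (\prod_(1 <= i < j) p i) * data_expect (fun C w y => Phi C w y *
    (accept_prob j (estimate j C y == w) * h true +
     (1 - accept_prob j (estimate j C y == w)) * h false)).
Proof.
move=> jk Phi_data Phi0 h0.
pose hh i b : R := if (i < j)%N then (~~ b)%:R else if i == j then h b else 1.
have -> : expect (fun C b w y =>
    Phi C w y * ((\prod_(1 <= i < j) (~~ accepts i b y)%:R) * h (accepts j b y))) =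
    expect (fun C b w y => Phi C w y * \prod_(1 <= i < k.+1) hh i (accepts i b y)).
  congr expect; apply/funext => C; apply/funext => b; apply/funext => w; apply/funext => y.
  rewrite -prod_nat_upto //; congr (_ * _); apply: eq_bigr => i _; rewrite /hh.
  by case: ifP => // _; case: eqP => [->|].
rewrite expect_factor // -data_expectZ; apply: data_expect_le => C w y.
rewrite [leRHS]mulrCA ler_wpM2l //.
set e := fun i => estimate i C y == w.
rewrite (eq_bigr (fun i => if (i < j)%N then 1 - accept_prob i (e i) else
  if i == j then accept_prob j (e j) * h true +
    (1 - accept_prob j (e j)) * h false else 1)); last first.
  move=> i _; rewrite /hh; case: ifP => _; first by rewrite mulr0 mulr1 add0r.
  by case: (i =P j) => [->//|_]; rewrite !mulr1 addrC subrK.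
rewrite prod_nat_upto // ler_wpM2r //.
  have /andP[a0 a1] := accept_prob01 j (e j).
  by rewrite addr_ge0 // mulr_ge0 // subr_ge0.
rewrite !big_nat; apply: ler_prod => i /andP[i1 ij].
have /andP[_ a1] := accept_prob01 i (e i); rewrite subr_ge0 a1 rej_le_p // i1.
by case/andP: jk => _ /(leq_trans (ltnW ij)).
Qed.

Variables (bet eps : nat -> R).
Hypothesis type1 : forall i, (1 <= i <= k)%N -> 1 - accept_prob i true <= eps i.
Hypothesis type2 : forall i, (1 <= i <= k)%N -> accept_prob i false = bet i.

Let p_ge0 i : (1 <= i <= k)%N -> 0 <= p i.
Proof.
move=> ik; apply: le_trans (rej_le_p true ik).
by rewrite subr_ge0; case/andP: (accept_prob01 i true).
Qed.

Let prodp_ge0 j : (j <= k.+1)%N -> 0 <= \prod_(1 <= i < j) p i.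
Proof.
move=> jk; rewrite big_nat; apply: prodr_ge0 => i /andP[i1 ij].
by apply: p_ge0; rewrite i1 -ltnS (leq_trans ij).
Qed.

Let err_data j : forall (C : book) w, data_only (fun y => (estimate j C y != w)%:R).
Proof. by move=> C w y y' /(estimate_data j C) ->. Qed.

(** A right estimate is rejected with probability at most [eps j], a wrong one with probability
    [1 - bet j], and it is wrong with probability at most the RCU value. *)
Lemma expect_reject (j : nat) : (1 <= j <= k)%N ->
  expect (fun C b w y => \prod_(1 <= i < j.+1) (~~ accepts i b y)%:R) <=
  (rcu W PX (sz j) M * (1 - bet j) + eps j) * \prod_(1 <= i < j) p i.
Proof.
move=> jk; have [j1 jk'] := andP jk.
have := @expect_stage_le j (fun _ _ _ => 1) (fun b => (~~ b)%:R) jk (fun _ _ _ _ _ => erefl)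
  (fun _ _ _ => ler01) (fun b => ler0n _ _).
set E := expect _; set E' := expect _ => le1.
have -> : E' = E.
  congr expect; apply/funext => C; apply/funext => b; apply/funext => w; apply/funext => y.
  by rewrite mul1r big_nat_recr.
apply: (le_trans le1); rewrite mulrC ler_wpM2r ?prodp_ge0 1?ltnW //.
have bet1 : 0 <= 1 - bet j by rewrite -type2 // subr_ge0; case/andP: (accept_prob01 j false).
apply: (@le_trans _ _ (data_expect
  (fun C w y => (1 - bet j) * (estimate j C y != w)%:R + eps j * 1))).
  apply: data_expect_le => C w y; rewrite mul1r mulr0 add0r !mulr1.
  case: eqP => _ /=; first by rewrite mulr0 add0r type1.
  (* For a wrong estimate the summand [eps j] is a surplus, nonnegative by [type1]. *)
  rewrite mulr1 type2 // lerDl; apply: le_trans (type1 jk).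
  by rewrite subr_ge0; case/andP: (accept_prob01 j true).
rewrite data_expectD !data_expectZ data_expect1 mulr1 lerD2r.
by rewrite mulrC ler_wpM2r ?data_expect_err.
Qed.

Lemma expect_accept_err (j : nat) : (1 <= j <= k)%N ->
  expect (fun C b w y => (estimate j C y != w)%:R *
     ((\prod_(1 <= i < j) (~~ accepts i b y)%:R) * (accepts j b y)%:R)) <=
  rcu W PX (sz j) M * bet j * \prod_(1 <= i < j) p i.
Proof.
move=> jk; have [j1 jk'] := andP jk.
apply: (le_trans (@expect_stage_le j (fun C w y => (estimate j C y != w)%:R) (fun b => b%:R) jk
  (err_data j) (fun _ _ _ => ler0n _ _) (fun b => ler0n _ _))).
rewrite [leRHS]mulrC ler_wpM2l ?prodp_ge0 1?ltnW //.
apply: (@le_trans _ _ (data_expect (fun C w y => bet j * (estimate j C y != w)%:R))).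
  apply: data_expect_le => C w y; rewrite mulr0 addr0 mulr1 mulrC.
  by case: eqP => _ /=; rewrite ?mulr0 ?type2.
rewrite data_expectZ mulrC ler_wpM2r ?data_expect_err // -type2 //.
by case/andP: (accept_prob01 j false).
Qed.

(** The error concerns estimate [k.+1], formed after the last test, so the [k]-th test may have
    faced a right or a wrong estimate and its rejection is bounded by [p k]. *)
Lemma expect_final_err : (1 <= k)%N ->
  expect (fun C b w y => (estimate k.+1 C y != w)%:R *
     \prod_(1 <= i < k.+1) (~~ accepts i b y)%:R) <=
  rcu W PX (sz k.+1) M * \prod_(1 <= i < k.+1) p i.
Proof.
move=> k1; have kk : (1 <= k <= k)%N by rewrite k1 leqnn.
have := @expect_stage_le k (fun C w y => (estimate k.+1 C y != w)%:R) (fun b => (~~ b)%:R) kk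
  (err_data k.+1) (fun _ _ _ => ler0n _ _) (fun b => ler0n _ _).
set E := expect _; set E' := expect _ => le1.
have -> : E' = E.
  congr expect; apply/funext => C; apply/funext => b; apply/funext => w; apply/funext => y.
  by rewrite big_nat_recr.
apply: (le_trans le1); rewrite big_nat_recr //= mulrCA ler_wpM2l ?prodp_ge0 //.
rewrite mulrC; apply: (@le_trans _ _ (data_expect
  (fun C w y => p k * (estimate k.+1 C y != w)%:R))).
  apply: data_expect_le => C w y; rewrite mulr0 add0r mulr1 mulrC ler_wpM2r //.
  exact: rej_le_p.
by rewrite data_expectZ ler_wpM2l ?p_ge0 ?data_expect_err.
Qed.

End Scheme.

(** * The schedule of data and control times *)

Section Schedule.
Local Open Scope nat_scope.
Variables (L N : nat) (nx : nat -> nat).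
Hypotheses (nx0 : nx 0 = 0) (nx_mono : {homo nx : i j / i <= j}).
Hypotheses (nx_sat : forall i, L <= i -> nx i = nx L) (nx_le : forall i, nx i <= N).

(** Times count from 0, so the instant [nx a] opens phase [a]. Even phases carry data; the odd phase
    [2i - 1] is the [i]-th control block. *)
Definition phase (t : nat) : nat := \sum_(1 <= i < L.+1) (nx i <= t).

Definition ctl_block (t : nat) : option nat :=
  if odd (phase t) then Some (phase t).+1./2 else None.

Lemma lt_nx_lt a : nx a < nx a.+1 -> a < L.
Proof.
move=> lt; rewrite ltnNge; apply: contraTN lt => La.
by rewrite !nx_sat ?ltnn // leqW.
Qed.

Lemma phaseE a t : nx a <= t < nx a.+1 -> phase t = a.
Proof.
move=> /andP [at_ ta]; have aL := lt_nx_lt (leq_ltn_trans at_ ta).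
rewrite /phase (big_cat_nat (n := a.+1)) //= 1?ltnW //.
rewrite [X in _ + X]big_nat [X in _ + X]big1 ?addn0; last first.
  by move=> i /andP[ai _]; rewrite leqNgt (leq_trans ta) // nx_mono.
rewrite (eq_big_nat _ _ (F2 := fun=> 1)) ?sum_nat_const_nat ?muln1 ?subn1 //.
by move=> i /andP[_ ia]; rewrite (leq_trans _ at_) // nx_mono.
Qed.

Lemma ex_phase t : t < nx L -> exists2 a, nx a <= t < nx a.+1 & phase t = a.
Proof.
move=> tL; have [a Ha] : exists a, nx a <= t < nx a.+1.
  have: exists b, t < nx b by exists L.
  case=> b; elim: b => [|b IHb tb]; first by rewrite nx0.
  by case: (ltnP t (nx b)) => [/IHb//|bt]; exists b; rewrite bt.
by exists a => //; apply: phaseE.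
Qed.

Definition ctl_len i := nx i.*2 - nx i.*2.-1.

Lemma ctl_pos_lt i (s : 'I_(ctl_len i)) : nx i.*2.-1 + s < nx i.*2.
Proof. by rewrite -ltn_subRL. Qed.

Definition ctl_pos i (s : 'I_(ctl_len i)) : 'I_N :=
  Ordinal (leq_trans (ctl_pos_lt s) (nx_le _)).

Lemma ctl_pos_inj i : injective (@ctl_pos i).
Proof. by move=> s s' /(congr1 val) /addnI /val_inj. Qed.

Lemma ctl_block_ctl_pos i (s : 'I_(ctl_len i)) : ctl_block (@ctl_pos i s) = Some i.
Proof.
(* [i = 0] names an empty block, as [0.*2.-1] is 0. *)
case: i s => [s|i s]; first by have : s < nx 0 - nx 0 := ltn_ord s; rewrite subnn.
have lt := ctl_pos_lt s.
rewrite /ctl_block (@phaseE i.*2.+1) /=.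
  by rewrite odd_double doubleK.
by rewrite leq_addr.
Qed.

(** From [j] to [j.+1] the range grows by the [j]-th control block, which contributes nothing, and
    by data block [j.+1], which counts in full. *)
Lemma card_data j :
  #|[set t : 'I_N | (ctl_block t == None) && (t < nx j.*2.-1)]| =
  \sum_(1 <= i < j.+1) (nx i.*2.-1 - nx i.*2.-2).
Proof.
transitivity (\sum_(0 <= t < nx j.*2.-1) (ctl_block t == None)).
  rewrite (big_nat_widen _ _ N) // big_mkord -sum1_card.
  rewrite [LHS]big_mkcond [RHS]big_mkcond; apply: eq_bigr => t _.
  by rewrite inE; do 2!case: ifP => //=; case: eqP.
elim: j => [|j IHj]; first by rewrite nx0 !big_geq.
rewrite [RHS]big_nat_recr //= -IHj.
rewrite (big_cat_nat (n := nx j.*2.-1)) //=; last first.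
  by apply: nx_mono; rewrite (leq_trans (leq_pred _)).
congr (_ + _).
rewrite (big_cat_nat (n := nx j.*2)) //=; last 2 first.
- by apply: nx_mono; rewrite leq_pred.
- by apply: nx_mono.
rewrite [X in X + _]big_nat [X in X + _]big1 ?add0n; last first.
  move=> t /andP[t1 t2]; case: j {IHj} t1 t2 => [|j] /=; first by rewrite nx0.
  by move=> t1 t2; rewrite /ctl_block (@phaseE j.*2.+1) ?t1 //= odd_double.
rewrite (eq_big_nat _ _ (F2 := fun=> 1)) ?sum_nat_const_nat ?muln1 //.
by move=> t Ht; rewrite /ctl_block (@phaseE j.*2) // odd_double.
Qed.

(** The cast through [card_data] gives the index type the blocklength that appears in the RCU
    terms. *)
Definition data_pos j (s : 'I_(\sum_(1 <= i < j.+1) (nx i.*2.-1 - nx i.*2.-2))) : 'I_N :=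
  enum_val (cast_ord (esym (card_data j)) s).

Lemma data_pos_inj j : injective (@data_pos j).
Proof. by move=> s s' /enum_val_inj /cast_ord_inj. Qed.

Lemma data_posP j (s : 'I_(\sum_(1 <= i < j.+1) (nx i.*2.-1 - nx i.*2.-2))) :
  (ctl_block (@data_pos j s) == None) && (@data_pos j s < nx j.*2.-1).
Proof. by have := enum_valP (cast_ord (esym (card_data j)) s); rewrite inE. Qed.

End Schedule.

(** * The code *)

(** Telescoping makes a stopping instant linear in the survival indicators [j <= J]. *)
Lemma sum_steps_upto (f : nat -> nat) (J k : nat) :
  {homo f : i j / (i <= j)%N} -> (J <= k)%N ->
  f J.+1 = (f 1 + \sum_(1 <= j < k.+1) (f j.+1 - f j) * (j <= J))%N.
Proof.
move=> f_mono Jk; rewrite (big_cat_nat (n := J.+1)) //=.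
rewrite [X in (_ + (_ + X))%N]big_nat [X in (_ + (_ + X))%N]big1 ?addn0; last first.
  by move=> j /andP[Jj _]; rewrite leqNgt Jj muln0.
rewrite (eq_big_nat _ _ (F2 := fun j => (f j.+1 - f j)%N)); last first.
  by move=> j /andP[_]; rewrite ltnS => ->; rewrite muln1.
elim: J {Jk} => [|J IHJ]; first by rewrite big_geq ?addn0.
by rewrite big_nat_recr //= addnA -IHJ subnKC // f_mono.
Qed.

Section Code.
Variables (R : realType) (X Y : finType) (W : X -> Y -> R) (PX : X -> R) (xA xR : X).
Variables (M k : nat) (n : nat -> nat) (w0 : 'I_M).
Hypotheses (W_channel : is_channel W) (PX_dist : is_dist PX).
Let L := k.*2.+1.
Hypothesis n_incr : forall i, (1 <= i < L)%N -> (n i < n i.+1)%N.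

(** Encodes [n_0 = 0] and, by saturation, [n_(L+1) = n_L]. *)
Definition fb_time (i : nat) : nat := if i == 0%N then 0%N else n (minn i k.*2.+1).

Lemma fb_time_sat i : (L <= i)%N -> fb_time i = fb_time L.
Proof. by case: i => [//|i] Li; rewrite /fb_time /= (minn_idPr Li) minnn. Qed.

Lemma fb_timeE i : (i < L)%N -> fb_time i.+1 = n i.+1.
Proof. by move=> iL; rewrite /fb_time /= (minn_idPl iL). Qed.

Lemma fb_time_mono : {homo fb_time : i j / (i <= j)%N}.
Proof.
apply: homo_leq => //; first exact: leq_trans.
case=> [//|i]; case: (ltnP i.+1 L) => [iL|Li].
  by rewrite (fb_timeE (ltnW iL)) (fb_timeE iL) ltnW // n_incr.
by rewrite !fb_time_sat // leqW.
Qed.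

Lemma fb_timeL : fb_time L = n L. Proof. by rewrite fb_timeE. Qed.

Lemma fb_time_le i : (fb_time i <= n L)%N.
Proof. by rewrite -fb_timeL; case: (leqP i L) => [/fb_time_mono//|/ltnW /fb_time_sat ->]. Qed.

Let N := n L.
Let ctl := ctl_block L fb_time.
Let m := ctl_len fb_time.
Let cpos := ctl_pos (N := N) fb_time_le.
Let sz j := (\sum_(1 <= i < j.+1) (fb_time i.*2.-1 - fb_time i.*2.-2))%N.
Let dpos : forall j, 'I_(sz j) -> 'I_N :=
  @data_pos L N fb_time erefl fb_time_mono fb_time_sat fb_time_le.

Variable T : forall i, {ffun 'I_(m i) -> Y} -> R.
Hypothesis T01 : forall i z, 0 <= @T i z <= 1.

Let book := {ffun 'I_M -> {ffun 'I_N -> X}}.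
Let coins := {ffun coin_index Y k m -> bool}.
Let est_ := estimate W PX dpos w0.
Let stop_ (b : coins) := stop_block cpos b.

Let ctl_cpos i s : ctl (@cpos i s) = Some i.
Proof. exact: (ctl_block_ctl_pos fb_time_mono fb_time_sat). Qed.

Let ctl_dpos j s : ctl (@dpos j s) = None.
Proof. by case/andP: (data_posP erefl fb_time_mono fb_time_sat fb_time_le s) => /eqP. Qed.

Let dpos_inj j : injective (@dpos j). Proof. exact: data_pos_inj. Qed.
Let cpos_inj i : injective (@cpos i). Proof. exact: ctl_pos_inj. Qed.

(* Block j + 1 ends at the feedback time of index 2j + 2, which tau encodes as
   2j + 1; when every test rejects, stop_ is k and the minimum selects the last
   feedback time.  The input xA is a filler for times beyond the horizon. *)
Definition sht_code : vlbf_code R X Y L M n :=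
  VLBF (L := L) (cr := (book * coins)%type)
    (fun u => book_prob PX u.1 * coins_prob T u.2)
    (fun t u w y => if insub t is Some s
      then chan_input W PX xA xR ctl dpos w0 u.1 w y s
      else xA)
    (fun u y => inord (minn (stop_ u.2 y).*2.+1 k.*2))
    (fun i u y => est_ i./2.+1 u.1 y).

(** * Causality of the code *)

Lemma estimate_prefix j a (C : book) (y y' : {ffun 'I_N -> Y}) :
  prefix_eq a y y' -> (fb_time j.*2.-1 <= a)%N -> est_ j C y = est_ j C y'.
Proof.
move=> yy' ja; apply: estimate_local => s; apply: yy'.
by case/andP: (data_posP erefl fb_time_mono fb_time_sat fb_time_le s) => _ /leq_trans; apply.
Qed.

Lemma accepts_prefix i a (b : coins) (y y' : {ffun 'I_N -> Y}) :
  (i <= k)%N -> prefix_eq a y y' -> (fb_time i.*2 <= a)%N ->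
  accepts cpos i b y = accepts cpos i b y'.
Proof.
move=> ik yy' ia; rewrite /accepts /coin_at; congr (b (Tagged _ _)).
apply/ffunP => s; rewrite !ffunE; apply: yy'.
by apply: leq_trans (ctl_pos_lt s) _; rewrite inordK.
Qed.

(** The tests up to the stopping one give the same verdicts on [y] and [y']; if the stopping blocks
    differed, the earlier one would be both accepted and rejected. *)
Lemma stop_block_prefix (b : coins) (y y' : {ffun 'I_N -> Y}) a :
  prefix_eq a y y' -> (fb_time (minn (stop_ b y).+1 k).*2 <= a)%N -> stop_ b y = stop_ b y'.
Proof.
move=> yy' Ja; set J := stop_ b y.
have agree i : (i <= J)%N -> (i < k)%N -> accepts cpos i.+1 b y = accepts cpos i.+1 b y'.
  move=> iJ ik; apply: accepts_prefix yy' _ => //; apply: leq_trans Ja.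
  by apply: fb_time_mono; rewrite leq_double leq_min ltnS iJ.
apply/eqP; rewrite eqn_leq; apply/andP; split.
  rewrite leqNgt; apply/negP => J'J.
  have J'k : (stop_ b y' < k)%N by apply: leq_trans J'J _; exact: stop_block_le.
  have := accepts_stop_block J'k; rewrite -(agree _ (ltnW J'J) J'k).
  by rewrite (not_accepts_before_stop J'J).
rewrite leqNgt; apply/negP => JJ'.
have Jk : (J < k)%N by apply: leq_trans JJ' _; exact: stop_block_le.
by have := accepts_stop_block Jk; rewrite agree // (not_accepts_before_stop JJ').
Qed.

Lemma code_tauE u y : @tau _ _ _ _ _ _ sht_code u y = minn (stop_ u.2 y).*2.+1 k.*2 :> nat.
Proof. by rewrite /= inordK // ltnS geq_minr. Qed.

Lemma code_valid : vlbf_valid sht_code.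
Proof.
have [P0 P1] := @book_prob_is_dist R X PX M N PX_dist.
have [Q0 Q1] := coins_prob_is_dist k T01.
split; [split=> [u|]|split; [|split]].
- by apply: mulr_ge0.
- rewrite -(pair_bigA _ (fun C b => book_prob PX C * coins_prob T b)) /=.
  by under eq_bigr do rewrite -mulr_sumr Q1 mulr1.
(* A control symbol uses the estimate formed at the instant that opened its block; this instant is
   at most the current time, hence at most [hfb]. *)
- move=> t u w y y' yy' /=; case: insubP => // s _ st.
  rewrite /chan_input; case E: (ctl s) => [i|//]; congr (if _ == w then _ else _).
  apply: (estimate_prefix _ yy').
  have sN : (s < fb_time L)%N by rewrite fb_timeL.
  have [a /andP[as_ sa] aE] := ex_phase erefl fb_time_mono fb_time_sat sN.
  move: E; rewrite /ctl /ctl_block aE; case: ifP => // aodd [<-].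
  have aL : (a < L)%N by apply: (lt_nx_lt fb_time_sat); apply: leq_ltn_trans as_ sa.
  case: a aodd as_ aL {sa aE} => // a /= aodd as_ aL.
  rewrite even_halfK //.
  have aL' : (a < L)%N by exact: ltnW.
  rewrite fb_timeE // -st; apply: (@leq_bigmax_cond _ _ (fun i : 'I_L => n i.+1) (Ordinal aL')).
  by rewrite /= -fb_timeE // -st.
- move=> u y y' i yy'.
  have half z z' : prefix_eq (n i.+1) z z' -> @tau _ _ _ _ _ _ sht_code u z = i ->
      @tau _ _ _ _ _ _ sht_code u z' = i.
    move=> zz' tz; apply: ord_inj; rewrite -tz !code_tauE.
    congr (minn _.*2.+1 _); apply/esym; apply: (stop_block_prefix zz').
    rewrite -fb_timeE // -tz code_tauE; apply: fb_time_mono.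
    have := stop_block_le cpos u.2 z; rewrite -/(stop_ _ _).
    (* If all tests reject, the last one ends at index [2k], while decoding waits for index
       [2k + 1]. *)
    case: (ltngtP (stop_ u.2 z) k) => // [Jk _|-> _].
      have J2 : ((stop_ u.2 z).*2.+1 <= k.*2)%N by rewrite ltn_double.
      by rewrite (minn_idPl Jk) (minn_idPl J2) doubleS.
    by rewrite (minn_idPr (leqnSn k)) (minn_idPr (leqnSn _)).
  by apply/eqP/eqP; apply: half => // t ti; rewrite yy'.
(* Estimate [i./2.+1] is complete at index [i./2.*2.+1], which is at most [i.+1]. *)
- move=> i u y y' yy' /=; apply: (estimate_prefix _ yy').
  rewrite -fb_timeE // doubleS /=; apply: fb_time_mono; rewrite ltnS.
  by rewrite -[leqRHS]odd_double_half leq_addl.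
Qed.

(** * Decoding time and error probability of the code *)

(** Book and coins are the common randomness, so the ensemble average is the performance of this one
    code and no good book has to be selected. *)
Lemma code_expect (F : book -> coins -> 'I_M -> {ffun 'I_N -> Y} -> R) :
  \sum_(u : cr sht_code) \sum_w \sum_y
    @vlbf_joint R X Y W L M n sht_code u w y * F u.1 u.2 w y =
  expect W PX xA xR ctl dpos T w0 F.
Proof.
rewrite -(pair_bigA _ (fun C b => \sum_w \sum_y
  @vlbf_joint R X Y W L M n sht_code (C, b) w y *
  F C b w y)).
apply: eq_bigr => C _; apply: eq_bigr => b _; rewrite mulr_sumr.
apply: eq_bigr => w _; rewrite mulrA mulr_sumr; apply: eq_bigr => y _.
rewrite mulrA; congr (_ * _ * _); apply: eq_bigr => t _.
by rewrite /= valK.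
Qed.

Lemma code_EtauE : vlbf_Etau W sht_code =
  (fb_time 2)%:R + \sum_(1 <= j < k.+1) (fb_time j.+1.*2 - fb_time j.*2)%:R *
    expect W PX xA xR ctl dpos T w0
      (fun _ (b : coins) _ y => \prod_(1 <= i < j.+1) (~~ accepts cpos i b y)%:R).
Proof.
pose c j : R := (fb_time j.+1.*2 - fb_time j.*2)%:R.
pose F j := fun (C : book) (b : coins) (w : 'I_M) (y : {ffun 'I_N -> Y}) =>
  c j * \prod_(1 <= i < j.+1) (~~ accepts cpos i b y)%:R.
transitivity (expect W PX xA xR ctl dpos T w0
    (fun C b w y => (fb_time 2)%:R * 1 + \sum_(1 <= j < k.+1) F j C b w y)).
  rewrite -code_expect; apply: eq_bigr => u _; apply: eq_bigr => w _.
  apply: eq_bigr => y _; congr (_ * _); rewrite code_tauE.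
  rewrite big_nat (eq_bigr
    (fun j => ((fb_time j.+1.*2 - fb_time j.*2) * (j <= stop_ u.2 y))%:R)); last first.
    by move=> j /andP[_ jk]; rewrite /F prod_reject // natrM.
  rewrite -big_nat -natr_sum mulr1 -natrD.
  rewrite -(@sum_steps_upto (fun j => fb_time j.*2)) ?stop_block_le //; last first.
    by move=> i j ij; rewrite fb_time_mono // leq_double.
  (* Saturation identifies index [min(2J+1, 2k) + 1] with index [2J + 2], also for [J = k]. *)
  by rewrite -fb_timeE ?ltnS ?geq_minr // /fb_time /= doubleS !minnSS -minnA minnn.
rewrite expectD expectZ expect1 // mulr1 expect_sum.
by congr (_ + _); apply: eq_bigr => j _; rewrite expectZ.
Qed.

(** Stopping in block [j] outputs estimate [j]; if no test accepts, the output is estimate [k.+1],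
    formed from all data blocks. *)
Lemma code_PerrE : vlbf_Perr W sht_code =
  \sum_(1 <= j < k.+1) expect W PX xA xR ctl dpos T w0
    (fun C (b : coins) w y => (est_ j C y != w)%:R *
       ((\prod_(1 <= i < j) (~~ accepts cpos i b y)%:R) * (accepts cpos j b y)%:R)) +
  expect W PX xA xR ctl dpos T w0
    (fun C (b : coins) w y => (est_ k.+1 C y != w)%:R *
      \prod_(1 <= i < k.+1) (~~ accepts cpos i b y)%:R).
Proof.
rewrite -expect_sum -expectD -code_expect.
apply: eq_bigr => u _; apply: eq_bigr => w _.
apply: eq_bigr => y _; congr (_ * _); rewrite [X in X != w]/= inordK ?ltnS ?geq_minr //.
rewrite prod_reject //.
rewrite big_nat (eq_bigr
  (fun j => (est_ j u.1 y != w)%:R * ((stop_ u.2 y).+1 == j)%:R)); last first.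
  by move=> j jk; rewrite prod_accept.
rewrite -big_nat; set J := stop_ u.2 y.
have : (J <= k)%N := stop_block_le _ _ _.
case: (ltngtP J k) => // [Jk _|Jk _].
  have -> : ((minn J.*2.+1 k.*2)./2 = J).
    rewrite (minn_idPl _) /= ?uphalf_double //.
    by rewrite -[leqLHS]/(J.*2.+1) ltn_double.
  rewrite mulr0 addr0 (bigD1_seq J.+1) ?mem_index_iota ?iota_uniq //= eqxx mulr1.
  by rewrite big1 ?addr0 // => j; rewrite eq_sym => /negPf ->; rewrite mulr0.
rewrite Jk (minn_idPr (leqnSn _)) doubleK mulr1 big_nat big1 ?add0r //.
by move=> j /andP[_ jk]; rewrite gtn_eqF ?mulr0.
Qed.

End Code.

Unset Implicit Arguments. Set Strict Implicit. Set Printing Implicit Defensive.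

Theorem theorem1 (R : realType) (X Y : finType) (W : X -> Y -> R) (PX : X -> R)
  (xA xR : X) (L M : nat) (n : nat -> nat) (eps : nat -> R) :
  (3 <= L)%N -> odd L ->
  is_channel W -> is_dist PX ->
  (0 < M)%N ->
  (0 < n 1)%N -> (forall i, (1 <= i < L)%N -> (n i < n i.+1)%N) ->
  (forall i, (1 <= i <= L.-1./2)%N -> 0 < eps i < 1) ->
  let k := L.-1./2 in
  let nx := fun i => if i == 0%N then 0%N else n (minn i L) in
  let bet := fun i =>
    beta_eps (eps i) (prod_dist (nx i.*2 - nx i.*2.-1)%N (W xA))
                     (prod_dist (nx i.*2 - nx i.*2.-1)%N (W xR)) in
  let p := fun i => if i == 0%N then 1 else Num.max (eps i) (1 - bet i) in
  let S := fun j => (\sum_(1 <= i < j.+1) (nx i.*2.-1 - nx i.*2.-2))%N in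
  exists c : vlbf_code R X Y L M n,
    vlbf_valid c /\
    vlbf_Etau W c <=
      (nx 2)%:R + \sum_(1 <= j < k.+1)
        (nx j.+1.*2 - nx j.*2)%:R *
        (rcu W PX (S j) M * (1 - bet j) + eps j) * \prod_(0 <= i < j) p i /\
    vlbf_Perr W c <=
      \sum_(1 <= j < k.+1) rcu W PX (S j) M * bet j * \prod_(0 <= i < j) p i
      + rcu W PX (S k.+1) M * \prod_(0 <= i < k.+1) p i.
Proof.
move=> L3 oddL W_channel PX_dist M_gt0 _.
have k_gt0 : (0 < L./2)%N := half_leq L3.
have Lk : L = L./2.*2.+1 by rewrite -[LHS]odd_double_half oddL.
move: (L./2) Lk k_gt0 => k {L3 oddL} -> k_gt0 n_incr.
have -> : k.*2.+1.-1./2 = k by exact: doubleK.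
move=> eps01.
(* [nx'] is [fb_time k n] by conversion, so [S j] is the number of data times read by estimate
   [j]. *)
move=> k' nx' bet p S; rewrite {}/k'.
(* The family of tests must be total in [i]; outside [1] to [k] the test that never accepts is a
   filler. *)
have tests i : exists T : {ffun 'I_(ctl_len (fb_time k n) i) -> Y} -> R,
    (forall z, 0 <= T z <= 1) /\ ((1 <= i <= k)%N ->
     \sum_z prod_dist (ctl_len (fb_time k n) i) (W xA) z * (1 - T z) <= eps i /\
     beta_eps (eps i) (prod_dist (ctl_len (fb_time k n) i) (W xA))
       (prod_dist (ctl_len (fb_time k n) i) (W xR)) =
       \sum_z prod_dist (ctl_len (fb_time k n) i) (W xR) z * T z).
  case: (boolP (1 <= i <= k)%N) => ik; last first.
    by exists (fun=> 0); split=> // z; rewrite lexx ler01.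
  have /andP[eps0 _] := eps01 i ik.
  have [T [T01 [T1 T2]]] := beta_epsP (ltW eps0)
    (prod_dist_is_dist (ctl_len (fb_time k n) i) (W_channel xA))
    (prod_dist_is_dist (ctl_len (fb_time k n) i) (W_channel xR)).
  by exists T; split=> // _; split.
pose T i := sval (cid (tests i)).
have T01 i z : 0 <= T i z <= 1 := (svalP (cid (tests i))).1 z.
have T12 i (ik : (1 <= i <= k)%N) := (svalP (cid (tests i))).2 ik.
pose w0 : 'I_M := Ordinal M_gt0.
pose a := accept_prob W xA xR T.
have type1 i : (1 <= i <= k)%N -> 1 - a i true <= eps i.
  move=> ik; apply: le_trans (T12 i ik).1.
  have [_ P1] := prod_dist_is_dist (ctl_len (fb_time k n) i) (W_channel xA).
  rewrite /a /accept_prob /test_mean -[X in X - _]P1 -sumrB; apply: ler_sum => z _.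
  by rewrite mulrBr mulr1.
have type2 i : (1 <= i <= k)%N -> a i false = bet i.
  by move=> ik; rewrite /bet (T12 i ik).2.
(* In the maximum, [eps i] covers a right estimate and [1 - bet i] a wrong one. *)
have rej_le_p i e : (1 <= i <= k)%N -> 1 - a i e <= p i.
  move=> ik; rewrite /p; case: i ik => [//|i] ik; rewrite le_max.
  by case: e; rewrite ?type1 // -type2 // lexx orbT.
have prodp j : \prod_(0 <= i < j.+1) p i = \prod_(1 <= i < j.+1) p i.
  by rewrite big_ltn // mul1r.
pose dpos := @data_pos k.*2.+1 (n k.*2.+1) (fb_time k n)
  erefl (fb_time_mono n_incr) (@fb_time_sat k n) (fb_time_le n_incr).
have cpos_inj i := @ctl_pos_inj _ _ (fb_time_le n_incr) i.
have dpos_inj j : injective (@dpos j) by exact: data_pos_inj.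
have ctl_cpos := ctl_block_ctl_pos
  (fb_time_mono n_incr) (@fb_time_sat k n) (fb_time_le n_incr).
have ctl_dpos j s : ctl_block k.*2.+1 (fb_time k n) (@dpos j s) = None.
  by case/andP: (data_posP erefl (fb_time_mono n_incr)
    (@fb_time_sat k n) (fb_time_le n_incr) s) => /eqP.
exists (sht_code W PX xA xR w0 n_incr T); split; last split.
- exact: code_valid.
- rewrite code_EtauE // lerD2l !big_nat; apply: ler_sum => -[//|j] jk.
  rewrite -mulrA ler_wpM2l // prodp.
  by apply: (expect_reject w0 W_channel PX_dist
      cpos_inj ctl_cpos dpos_inj ctl_dpos T01 rej_le_p type1 type2).
- rewrite code_PerrE // lerD //.
    rewrite !big_nat; apply: ler_sum => -[//|j] jk; rewrite prodp.
    by apply: (expect_accept_err w0 W_channel PX_dist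
      cpos_inj ctl_cpos dpos_inj ctl_dpos T01 rej_le_p type2).
  rewrite prodp.
  by apply: (expect_final_err w0 W_channel PX_dist
      cpos_inj ctl_cpos dpos_inj ctl_dpos T01 rej_le_p).
Qed.
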